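(* Let $\mathcal{M}=\{M^x:x\in\Lambda\}$ be a standard log-convex weight matrix. For $x\in\Lambda$ and $l_1,l_2,\dots>0$ define recursively, for $i\in\mathbb{N}$ and $j\ge1$, $$M^{x;l_1}_i:=\exp\Big(\tfrac1{l_1}\varphi^*_{\omega_{M^x}}(l_1i)\Big),\qquad M^{x;l_1,\dots,l_{j+1}}_i:=\exp\Big(\tfrac1{l_{j+1}}\varphi^*_{\omega_{M^{x;l_1,\dots,l_j}}}(l_{j+1}i)\Big),$$ and let $\mathcal{M}_j:=\{M^{x;l_1,\dots,l_j}:x\in\Lambda,\ l_1,\dots,l_j>0\}$ for $j\ge 1$. Then after the first step the construction always yields equivalent matrices: for all $j,k\in\mathbb{N}_{>0}$ one has both $\mathcal{M}_j\{\approx\}\mathcal{M}_k$ and $\mathcal{M}_j(\approx)\mathcal{M}_k$.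
   Context: $\mathbb{N}=\{0,1,2,\dots\}$. A weight sequence is $M=(M_k)_{k\in\mathbb{N}}$ with $M_k>0$. It is normalized if $1=M_0\le M_1$, log-convex if $M_j^2\le M_{j-1}M_{j+1}$ for all $j\ge1$. $\mathcal{LC}$ is the set of normalized log-convex $M$ with $\lim_{k\to\infty}(M_k)^{1/k}=+\infty$. $(\Lambda,\le)$ is a partially ordered set which is both upward and downward directed. A weight matrix is a family $\mathcal{M}=\{M^x:x\in\Lambda\}$ of normalized, increasing weight sequences with $M^x\le M^y$ (termwise) for $x\le y$. It is standard log-convex if moreover every $M^x\in\mathcal{LC}$. Associated function: $\omega_M(t):=\sup_{p\in\mathbb{N}}\log(t^p/M_p)$ for $t>0$, $\omega_M(0):=0$ (here $M_0=1$). For a function $\omega$ on $[0,\infty)$ put $\varphi_\omega(y):=\omega(e^y)$ and $\varphi^*_\omega(x):=\sup\{xy-\varphi_\omega(y):y\ge0\}$, $x\ge0$. For sequences, $M\preceq N$ means $\sup_{p\ge1}(M_p/N_p)^{1/p}<+\infty$. For families $\mathcal{M}=\{M^x:x\in\Lambda\}$, $\mathcal{N}=\{N^y:y\in\Lambda'\}$: $\mathcal{M}\{\preceq\}\mathcal{N}$ means $\forall x\in\Lambda\ \exists y\in\Lambda':M^x\preceq N^y$; $\mathcal{M}(\preceq)\mathcal{N}$ means $\forall y\in\Lambda'\ \exists x\in\Lambda:M^x\preceq N^y$. $\mathcal{M}\{\approx\}\mathcal{N}$ means $\mathcal{M}\{\preceq\}\mathcal{N}$ and $\mathcal{N}\{\preceq\}\mathcal{M}$;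 $\mathcal{M}(\approx)\mathcal{N}$ means $\mathcal{M}(\preceq)\mathcal{N}$ and $\mathcal{N}(\preceq)\mathcal{M}$. *)

(* Defs.v *)
From HB Require Import structures.
From mathcomp Require Import all_boot all_order all_algebra.
From mathcomp Require Import all_classical all_reals all_analysis.

Set Implicit Arguments.
Unset Strict Implicit.
Unset Printing Implicit Defensive.

Import Order.TTheory GRing.Theory Num.Theory.
Import numFieldNormedType.Exports.

Local Open Scope classical_set_scope.
Local Open Scope ring_scope.

Section Sequences.
Context {R : realType}.

Definition weight_sequence (M : R^nat) : Prop := forall k, 0 < M k.

Definition normalized (M : R^nat) : Prop := M 0%N = 1 /\ 1 <= M 1%N.

Definition log_convex (M : R^nat) : Prop :=
  forall j, (1 <= j)%N -> M j ^+ 2 <= M j.-1 * M j.+1.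

(* The value of the root at k = 0 is a junk value, irrelevant to the limit. *)
Definition LC (M : R^nat) : Prop :=
  [/\ weight_sequence M, normalized M, log_convex M &
      M k `^ k%:R^-1 @[k --> \oo] --> +oo].

(* For M in LC and t > 0 the supremum is finite, so that the real-valued [sup]
   is the true one. *)
Definition omega (M : R^nat) (t : R) : R :=
  if 0 < t then sup [set ln (t ^+ p / M p) | p in [set: nat]] else 0.

Definition phi (w : R -> R) (y : R) : R := w (expR y).

(* When w = omega M with M in LC and 0 <= x, the supremum is again finite. *)
Definition phi_conj (w : R -> R) (x : R) : R :=
  sup [set x * y - phi w y | y in [set y : R | 0 <= y]].

(* One step of the construction; applied to M^{x;l_1,...,l_j} and l_{j+1} it
   yields M^{x;l_1,...,l_{j+1}}. It maps LC to LC for l > 0, so all suprema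
   occurring in its iterates are finite. *)
Definition next_sequence (M : R^nat) (l : R) : R^nat :=
  fun i => expR (l^-1 * phi_conj (omega M) (l * i%:R)).

Definition preceq (M N : R^nat) : Prop :=
  (ereal_sup [set ((M p / N p) `^ p%:R^-1)%:E | p in [set p | (1 <= p)%N]]
   < +oo)%E.

End Sequences.

Section Families.
Context {R : realType}.

Definition roumieu_preceq (I J : Type) (M : I -> R^nat) (N : J -> R^nat) :=
  forall x, exists y, preceq (M x) (N y).

Definition beurling_preceq (I J : Type) (M : I -> R^nat) (N : J -> R^nat) :=
  forall y, exists x, preceq (M x) (N y).

Definition roumieu_equiv (I J : Type) (M : I -> R^nat) (N : J -> R^nat) :=
  roumieu_preceq M N /\ roumieu_preceq N M.

Definition beurling_equiv (I J : Type) (M : I -> R^nat) (N : J -> R^nat) :=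
  beurling_preceq M N /\ beurling_preceq N M.

End Families.

Definition up_down_directed (d : Order.disp_t) (Lambda : porderType d) : Prop :=
  (forall x y : Lambda, exists z : Lambda, (x <= z)%O /\ (y <= z)%O) /\
  (forall x y : Lambda, exists z : Lambda, (z <= x)%O /\ (z <= y)%O).

Section Matrices.
Context {R : realType} {d : Order.disp_t} {Lambda : porderType d}.

Definition weight_matrix (M : Lambda -> R^nat) : Prop :=
  [/\ up_down_directed Lambda,
      forall x, [/\ weight_sequence (M x), normalized (M x) &
                    nondecreasing_seq (M x)] &
      forall x y, (x <= y)%O -> forall k, M x k <= M y k].

Definition standard_log_convex (M : Lambda -> R^nat) : Prop :=
  weight_matrix M /\ forall x, LC (M x).

(* The family M_j, indexed by (x, (l_1, ..., l_j)); l_1 is applied first. *)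
Definition iterated_matrix (M : Lambda -> R^nat) (j : nat)
    (a : Lambda * j.-tuple {posnum R}) : R^nat :=
  foldl (fun N (l : {posnum R}) => next_sequence N l%:num) (M a.1) a.2.

End Matrices.

Arguments iterated_matrix {R d Lambda} M j a _.

(* Main.v *)
Require Import Defs.
From mathcomp Require Import all_boot all_order all_algebra.
From mathcomp Require Import all_classical all_reals all_analysis.
From mathcomp Require Import lra.

(** Write [T_l M] for [next_sequence M l] and [M^*] for [phi_conj (omega M)].
    The function [s |-> M^* s / s] is nondecreasing, and comparing [p] with the
    multiple of [l] just below it gives
    [l * omega (T_l M) <= omega M <= 2 * l * omega (T_l M) + D] on [1, oo[.
    Conjugating, [T_(a l) M <= T_l (T_a M) <= C * T_(2 a l) M]. As [T_l] is
    monotone up to multiplicative constants, the sequence with parameters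
    [l_1, ..., l_j] lies, up to constants, between [T_P M] and [T_(2^(j-1) P) M]
    where [P = l_1 * ... * l_j]; both families are thus equivalent to
    [{T_l (M x)}]. *)

Set Implicit Arguments.
Unset Strict Implicit.
Unset Printing Implicit Defensive.

Import Order.TTheory GRing.Theory Num.Theory.
Import numFieldNormedType.Exports.

Local Open Scope classical_set_scope.
Local Open Scope ring_scope.

Section Step.
Context {R : realType}.
Implicit Types (M N A B : R^nat) (l x y c : R).

(* What the argument uses of LC; unlike LC it is visibly stable under
   [next_sequence]. *)
Definition admissible M : Prop :=
  [/\ M 0%N = 1, forall p, 1 <= M p &
      forall y, has_ubound [set p%:R * y - ln (M p) | p in [set: nat]]].

(** A constant factor, not the geometric factor allowed by [preceq]: it shifts [phi (omega _)] only
    by a constant, so it survives [next_sequence]. *)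
Definition dominated A B : Prop :=
  exists2 C, 0 < C & forall p, A p <= C * B p.

(** * The associated function and its conjugate *)

Lemma phi_omegaE M y : (forall p, 1 <= M p) ->
  phi (omega M) y = sup [set p%:R * y - ln (M p) | p in [set: nat]].
Proof.
move=> M1; rewrite /phi /omega expR_gt0; congr sup.
apply: eq_imagel => p _.
have Mp : 0 < M p := lt_le_trans ltr01 (M1 p).
by rewrite ln_div ?posrE ?exprn_gt0 ?expR_gt0// lnXn ?expR_gt0// expRK mulr_natl.
Qed.

Lemma phi_omega_ge M p y : admissible M ->
  p%:R * y - ln (M p) <= phi (omega M) y.
Proof.
by case=> _ M1 ub; rewrite phi_omegaE//; apply: ub_le_sup => //; exists p.
Qed.

Lemma phi_omega_le M y c : admissible M ->
  (forall p, p%:R * y - ln (M p) <= c) -> phi (omega M) y <= c.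
Proof.
case=> _ M1 _ h; rewrite phi_omegaE//; apply: ge_sup; first by eexists; exists 0%N.
by move=> _ [p _ <-].
Qed.

Lemma phi_omega_ge0 M y : admissible M -> 0 <= phi (omega M) y.
Proof.
move=> aM; have := phi_omega_ge 0 y aM.
by case: aM => -> _ _; rewrite ln1 mul0r subr0.
Qed.

Lemma phi_omega0 M : admissible M -> phi (omega M) 0 = 0.
Proof.
move=> aM; apply/eqP; rewrite eq_le phi_omega_ge0// andbT.
apply: phi_omega_le => // p; case: aM => _ M1 _.
by rewrite mulr0 sub0r oppr_le0 ln_ge0.
Qed.

Lemma phi_conj_le w x c :
  (forall y, 0 <= y -> x * y - phi w y <= c) -> phi_conj w x <= c.
Proof.
move=> h; apply: ge_sup; first by eexists; exists 0 => /=.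
by move=> _ [y y0 <-]; exact: h.
Qed.

Lemma phi_conj_ge M x y : admissible M -> 0 <= y ->
  x * y - phi (omega M) y <= phi_conj (omega M) x.
Proof.
move=> aM y0; apply: ub_le_sup; last by exists y.
have [p xp] : exists p : nat, x <= p%:R.
  by exists (Num.bound `|x|); apply/ltW/(le_lt_trans (ler_norm x)); exact: archi_boundP.
(* For [x <= p] and [0 <= z], the term of index [p] in [phi (omega M) z] bounds [x * z] up to
   [ln (M p)]. *)
exists (ln (M p)) => _ [z /= z0 <-].
have := phi_omega_ge p z aM; have := ler_wpM2r z0 xp; lra.
Qed.

Lemma phi_conj_ge0 M x : admissible M -> 0 <= phi_conj (omega M) x.
Proof.
move=> aM; have := phi_conj_ge x aM (lexx 0).
by rewrite phi_omega0// mulr0 subr0.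
Qed.

Lemma phi_conj0 M : admissible M -> phi_conj (omega M) 0 = 0.
Proof.
move=> aM; apply/eqP; rewrite eq_le phi_conj_ge0// andbT.
by apply: phi_conj_le => y _; rewrite mul0r sub0r oppr_le0 phi_omega_ge0.
Qed.

Lemma phi_conj_nat_le M p : admissible M -> phi_conj (omega M) p%:R <= ln (M p).
Proof.
by move=> aM; apply: phi_conj_le => y _; have := phi_omega_ge p y aM; lra.
Qed.

(** As [phi (omega M)] is nonnegative and [c <= 1], subtracting it in full gives no more than
    subtracting [c] times it. *)
Lemma phi_conj_slope M c x : admissible M -> 0 <= c <= 1 ->
  phi_conj (omega M) (c * x) <= c * phi_conj (omega M) x.
Proof.
move=> aM /andP[c0 c1]; apply: phi_conj_le => y y0.
have := ler_wpM2l c0 (phi_conj_ge x aM y0).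
have := ler_wpM2r (phi_omega_ge0 y aM) c1; lra.
Qed.

(** * The associated function after one step *)

Lemma ln_next_sequence M l p :
  ln (next_sequence M l p) = l^-1 * phi_conj (omega M) (l * p%:R).
Proof. by rewrite /next_sequence expRK. Qed.

Lemma next_sequence_young M l p y : admissible M -> 0 < l -> 0 <= y ->
  p%:R * y - ln (next_sequence M l p) <= l^-1 * phi (omega M) y.
Proof.
move=> aM l0 y0; rewrite ln_next_sequence.
have li0 : 0 <= l^-1 by rewrite invr_ge0 ltW.
have := ler_wpM2l li0 (phi_conj_ge (l * p%:R) aM y0).
rewrite mulrBr -mulrA mulKf ?gt_eqF//; lra.
Qed.

Lemma admissible_next M l : admissible M -> 0 < l ->
  admissible (next_sequence M l).
Proof.
move=> aM l0.
have N1 p : 1 <= next_sequence M l p.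
  by rewrite /next_sequence -expR0 ler_expR mulr_ge0 ?invr_ge0 ?phi_conj_ge0// ltW.
split=> //.
  by rewrite /next_sequence mulr0 phi_conj0// mulr0 expR0.
move=> y; have [y0|y0] := leP 0 y.
  by exists (l^-1 * phi (omega M) y) => _ [p _ <-]; exact: next_sequence_young.
exists 0 => _ [p _ <-]; rewrite subr_le0; apply: (@le_trans _ _ 0).
  by rewrite mulr_ge0_le0// ltW.
exact: ln_ge0.
Qed.

Lemma phi_omega_next_le M l y : admissible M -> 0 < l -> 0 <= y ->
  phi (omega (next_sequence M l)) y <= l^-1 * phi (omega M) y.
Proof.
move=> aM l0 y0; apply: phi_omega_le; first exact: admissible_next.
by move=> p; exact: next_sequence_young.
Qed.

(** [next_sequence M l] samples the conjugate of [M] at multiples of [l]. For [l <= p] the multiple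
    [l * q] just below [p] is at least [p / 2], so by [phi_conj_slope] its term loses at most a
    factor 2. *)
Lemma phi_omega_le_next M l : admissible M -> 0 < l ->
  exists D, forall y, 0 <= y ->
    phi (omega M) y <= 2 * l * phi (omega (next_sequence M l)) y + D.
Proof.
move=> aM l0; set N := next_sequence M l.
have aN : admissible N := admissible_next aM l0.
(* The term of index 1 gives [y <= phi (omega N) y + ln (N 1)], which settles all [p < l]. *)
exists (2 * l * ln (N 1%N)) => y y0.
have lnN0 : 0 <= ln (N 1%N) by case: aN => _ N1 _; rewrite ln_ge0.
have D0 : 0 <= 2 * l * ln (N 1%N) by rewrite !mulr_ge0// ltW.
have W0 : 0 <= 2 * l * phi (omega N) y by rewrite !mulr_ge0 ?phi_omega_ge0// ltW.
apply: phi_omega_le => // p.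
have conj_le := phi_conj_nat_le p aM.
have [pl|lp] := ltP p%:R l.
  have : p%:R * y <= l * y by rewrite ler_wpM2r// ltW.
  have := ler_wpM2l (ltW l0) (phi_omega_ge 1 y aN).
  have ly0 : 0 <= l * y by rewrite mulr_ge0// ltW.
  have := phi_conj_ge0 p%:R aM; rewrite mul1r; lra.
(* Positivity of this quantity is what later allows multiplying it by [1 <= 2 * c]. *)
have [g0|g0] := leP (p%:R * y - phi_conj (omega M) p%:R) 0; first lra.
have p0 : 0 < p%:R :> R := lt_le_trans l0 lp.
pose q := Num.truncn (p%:R / l).
have /andP[qle qlt] : q%:R <= p%:R / l < q.+1%:R.
  by apply: truncn_itv; rewrite divr_ge0// ltW.
have q1 : 1 <= q%:R :> R.
  rewrite (ler_nat _ 1%N) truncn_ge_nat ?divr_ge0// ?ler_pdivlMr ?mul1r//.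
  exact: ltW.
move: qle qlt; rewrite ler_pdivlMr// ltr_pdivrMr// => qle qlt.
pose c := l * q%:R / p%:R.
have cp : c * p%:R = l * q%:R by rewrite /c divfK// gt_eqF.
have c1 : 0 <= c <= 1.
  by rewrite /c divr_ge0 ?mulr_ge0 ?(ltW l0)//= ler_pdivrMr// mul1r mulrC.
(* Since [1 <= q], one has [p < l * (q + 1) <= 2 * l * q]. *)
have c2 : 1 <= 2 * c.
  have : l <= l * q%:R by rewrite ler_peMr// ltW.
  rewrite /c mulrA ler_pdivlMr// mul1r; move: qlt; rewrite -natr1; lra.
have slope := phi_conj_slope p%:R aM c1.
have := ler_wpM2l (ltW l0) (phi_omega_ge q y aN).
rewrite ln_next_sequence mulrBr mulVKf ?gt_eqF// mulrA -cp.
have := ler_wpM2r (ltW g0) c2; lra.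
Qed.

(** * Domination up to a constant factor *)

Lemma dominated_refl A : (forall p, 0 <= A p) -> dominated A A.
Proof. by move=> A0; exists 1 => // p; rewrite mul1r. Qed.

Lemma dominated_trans B A N : dominated A B -> dominated B N -> dominated A N.
Proof.
move=> [C C0 AB] [D D0 BN]; exists (C * D) => [|p]; first exact: mulr_gt0.
by apply: le_trans (AB p) _; rewrite -mulrA ler_pM2l.
Qed.

Lemma dominated_next_expR M N a b D :
  (forall p, a^-1 * phi_conj (omega M) (a * p%:R) <=
             b^-1 * phi_conj (omega N) (b * p%:R) + D) ->
  dominated (next_sequence M a) (next_sequence N b).
Proof.
move=> h; exists (expR D) => [|p]; first exact: expR_gt0.
by rewrite /next_sequence -expRD ler_expR addrC.
Qed.

(** The order is reversed in passing to [omega] and again by conjugation. The shift [ln C] persists,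
    so the new constant is [C] to the power [l^-1]. *)
Lemma dominated_next A B l : admissible A -> admissible B -> 0 < l ->
  dominated A B -> dominated (next_sequence A l) (next_sequence B l).
Proof.
move=> aA aB l0 [C C0 AB].
apply: (@dominated_next_expR _ _ _ _ (l^-1 * ln C)) => p.
rewrite -mulrDr ler_wpM2l ?invr_ge0 ?(ltW l0)//.
apply: phi_conj_le => y y0.
have : phi (omega B) y <= phi (omega A) y + ln C.
  apply: phi_omega_le => // k.
  have [_ /(_ k) A1 _] := aA; have [_ /(_ k) B1 _] := aB.
  have Ak : 0 < A k := lt_le_trans ltr01 A1.
  have Bk : 0 < B k := lt_le_trans ltr01 B1.
  have : ln (A k) <= ln C + ln (B k).
    by rewrite -lnM ?posrE// ler_ln ?posrE ?mulr_gt0.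
  by have := phi_omega_ge k y aA; lra.
by have := phi_conj_ge (l * p%:R) aB y0; lra.
Qed.

(** Conjugate of [phi_omega_next_le]; no additive term occurs, so the constant is 1. *)
Lemma dominated_next_mul M a l : admissible M -> 0 < a -> 0 < l ->
  dominated (next_sequence M (a * l)) (next_sequence (next_sequence M a) l).
Proof.
move=> aM a0 l0; apply: (@dominated_next_expR _ _ _ _ 0) => p; rewrite addr0.
rewrite invfM (mulrC a^-1) -mulrA ler_wpM2l ?invr_ge0 ?(ltW l0)//.
rewrite mulrC ler_pdivrMr//; apply: phi_conj_le => y y0.
have aN := admissible_next aM a0.
have := ler_wpM2l (ltW a0) (phi_conj_ge (l * p%:R) aN y0).
have := ler_wpM2l (ltW a0) (phi_omega_next_le aM a0 y0).
rewrite mulVKf ?gt_eqF//; lra.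
Qed.

(** Conjugate of [phi_omega_le_next]: the factor [2 * a] rescales the argument, and [D] becomes a
    multiplicative constant. *)
Lemma dominated_next_next M a l : admissible M -> 0 < a -> 0 < l ->
  dominated (next_sequence (next_sequence M a) l)
            (next_sequence M (2 * a * l)).
Proof.
move=> aM a0 l0; have [D hD] := phi_omega_le_next aM a0.
have a20 : 0 < 2 * a by rewrite mulr_gt0.
apply: (@dominated_next_expR _ _ _ _ (l^-1 * ((2 * a)^-1 * D))) => p.
rewrite invfM (mulrC (2 * a)^-1) -[X in _ <= X + _]mulrA -mulrDr -mulrDr.
rewrite ler_wpM2l ?invr_ge0 ?(ltW l0)//.
apply: phi_conj_le => y y0; rewrite [leRHS]mulrC ler_pdivlMr//.
have := phi_conj_ge (2 * a * l * p%:R) aM y0; have := hD y y0; lra.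
Qed.

(** Since [foldl] changes the starting sequence, the induction runs over every [N] between two
    one-step sequences of [M]. Each parameter [l] turns [a] into [a * l] and [b] into
    [2 * b * l]. *)
Lemma foldl_next_bounds M (s : seq {posnum R}) N a b :
  admissible M -> admissible N -> 0 < a -> 0 < b ->
  dominated (next_sequence M a) N -> dominated N (next_sequence M b) ->
  let P := \prod_(l <- s) l%:num in
  let F := foldl (fun N (l : {posnum R}) => next_sequence N l%:num) N s in
  dominated (next_sequence M (a * P)) F /\
  dominated F (next_sequence M (2 ^+ size s * b * P)).
Proof.
move=> aM; elim: s N a b => [|l s IH] N a b aN a0 b0 aN_ Nb /=.
  by rewrite big_nil !mulr1 mul1r.
rewrite big_cons mulrA.
rewrite [_ * b * _](_ : _ = 2 ^+ size s * (2 * b * l%:num) *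
  \prod_(l <- s) l%:num); last by rewrite exprSr !mulrA.
have l0 : 0 < l%:num by [].
apply: (IH (next_sequence N l%:num)).
- exact: admissible_next.
- exact: mulr_gt0.
- by rewrite !mulr_gt0.
- apply: dominated_trans (dominated_next_mul aM a0 l0) _.
  by apply: dominated_next aN_; rewrite ?l0//; exact: admissible_next.
- apply: (dominated_trans _ (dominated_next_next aM b0 l0)).
  by apply: dominated_next Nb; rewrite ?l0//; exact: admissible_next.
Qed.

(** * Links with [preceq] and [LC] *)

Lemma dominated_preceq A B : (forall p, 0 < A p) -> (forall p, 0 < B p) ->
  dominated A B -> preceq A B.
Proof.
move=> A0 B0 [C C0 AB]; rewrite /preceq.
(* If [C < 1], its roots of order [p > 1] exceed [C], hence the maximum with 1. *)
apply: (@le_lt_trans _ _ (Num.max 1 C)%:E); last exact: ltry.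
apply: ge_ereal_sup => _ [p /= p1 <-]; rewrite lee_fin.
have m1 : 1 <= Num.max 1 C by rewrite le_max lexx.
apply: (@le_trans _ _ (Num.max 1 C `^ p%:R^-1)).
  apply: ge0_ler_powR; rewrite ?invr_ge0 ?nnegrE ?(le_trans ler01 m1)//.
    by rewrite divr_ge0// ltW.
  by rewrite ler_pdivrMr// (le_trans (AB p))// ler_pM2r// le_max lexx orbT.
rewrite -[leRHS]powRr1 ?(le_trans ler01 m1)// ler_powR//.
by rewrite invf_le1 ?ler1n// ltr0n.
Qed.

Lemma has_ubound_eventually_le (u : R^nat) c :
  (\forall n \near \oo, u n <= c) -> has_ubound [set u n | n in [set: nat]].
Proof.
move=> [n _ hn]; exists (Num.max c (\sum_(i < n) `|u i|)) => _ [p _ <-].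
rewrite le_max; have [np|pn] := leqP n p; first by rewrite (hn p).
apply/orP; right; apply: le_trans (ler_norm _) _.
by rewrite (bigD1 (Ordinal pn))//= lerDl sumr_ge0.
Qed.

(** Once the root of [M p] exceeds [expR y], the term [p * y - ln (M p)] is at most 0; only finitely
    many terms remain. *)
Lemma LC_admissible M : LC M -> nondecreasing_seq M -> admissible M.
Proof.
move=> [M0 [M01 _] _ Moo] Mnd.
have M1 p : 1 <= M p by rewrite -M01 Mnd.
split=> // y; apply: (@has_ubound_eventually_le _ 0).
move/cvgryPge: Moo => /(_ (expR y)) Moo.
near=> p.
have p0 : 0 < p%:R :> R by rewrite ltr0n; near: p; exact: nbhs_infty_gt.
have : expR y <= M p `^ p%:R^-1 by near: p.
rewrite -ler_ln ?posrE ?expR_gt0 ?powR_gt0// expRK ln_powR mulrC.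
by rewrite ler_pdivlMr// mulrC subr_le0.
Unshelve. all: by end_near. Qed.

End Step.

(** * Comparison of the iterated matrices *)

Section Iterated.
Context {R : realType} {d : Order.disp_t} {Lambda : porderType d}.
Variable M : Lambda -> R^nat.
Hypothesis aM : forall x, admissible (M x).

Lemma iterated_matrix_bounds j (a : Lambda * j.+1.-tuple {posnum R}) :
  let P := \prod_(l <- a.2) l%:num in
  dominated (next_sequence (M a.1) P) (iterated_matrix M j.+1 a) /\
  dominated (iterated_matrix M j.+1 a) (next_sequence (M a.1) (2 ^+ j * P)).
Proof.
case: a => x [[//|l s] sizeP]; rewrite /iterated_matrix/= big_cons.
have <- : size s = j by apply/eqP.
rewrite [2 ^+ _ * _](_ : _ =
  2 ^+ size s * l%:num * \prod_(l <- s) l%:num); last by rewrite !mulrA.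
(* The first step is compared with itself, so only the other [j] steps cost a factor 2. *)
have refl : dominated (next_sequence (M x) l%:num) (next_sequence (M x) l%:num).
  by apply: dominated_refl => p; rewrite expR_ge0.
by apply: foldl_next_bounds => //; exact: admissible_next.
Qed.

Lemma iterated_matrix_gt0 j (a : Lambda * j.+1.-tuple {posnum R}) p :
  0 < iterated_matrix M j.+1 a p.
Proof.
case: a => x [s /= sj]; rewrite /iterated_matrix/=.
case/lastP: s sj => [//|s l] _.
by rewrite foldl_rcons expR_gt0.
Qed.

(** The parameters are matched so that the upper bound for [a] is the lower bound for [b]. *)
Lemma iterated_matrix_preceq j k (a : Lambda * j.+1.-tuple {posnum R})
    (b : Lambda * k.+1.-tuple {posnum R}) :
  a.1 = b.1 ->
  2 ^+ j * \prod_(l <- a.2) l%:num = \prod_(l <- b.2) l%:num ->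
  preceq (iterated_matrix M j.+1 a) (iterated_matrix M k.+1 b).
Proof.
move=> ab Pab; apply: dominated_preceq; try exact: iterated_matrix_gt0.
have [_] := iterated_matrix_bounds a; rewrite ab Pab => /dominated_trans; apply.
by have [] := iterated_matrix_bounds b.
Qed.

Lemma tuple_prod_exists j (c : R) : 0 < c ->
  exists s : j.+1.-tuple {posnum R}, \prod_(l <- s) l%:num = c.
Proof.
move=> c0; exists (cons_tuple (PosNum c0) (nseq_tuple j 1%:pos)).
by rewrite big_cons/= big_nseq iter_fix ?mulr1//= mulr1.
Qed.

Lemma iterated_matrix_roumieu_preceq j k :
  roumieu_preceq (iterated_matrix M j.+1) (iterated_matrix M k.+1).
Proof.
move=> a; have c0 : 0 < 2 ^+ j * \prod_(l <- a.2) l%:num.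
  by rewrite mulr_gt0 ?exprn_gt0// prodr_gt0.
have [s sE] := tuple_prod_exists k c0.
by exists (a.1, s); apply: iterated_matrix_preceq.
Qed.

Lemma iterated_matrix_beurling_preceq j k :
  beurling_preceq (iterated_matrix M j.+1) (iterated_matrix M k.+1).
Proof.
(* Here the smaller family is to be found, so its product is divided by [2 ^+ j] in advance. *)
move=> b; have c0 : 0 < 2 ^- j * \prod_(l <- b.2) l%:num.
  by rewrite mulr_gt0 ?invr_gt0 ?exprn_gt0// prodr_gt0.
have [s sE] := tuple_prod_exists j c0.
exists (b.1, s); apply: iterated_matrix_preceq => //=.
by rewrite sE mulVKf// expf_neq0.
Qed.

End Iterated.

Theorem corollary3p8 (R : realType) (d : Order.disp_t) (Lambda : porderType d)
    (M : Lambda -> nat -> R) (hM : standard_log_convex M)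
    (j k : nat) (hj : (0 < j)%N) (hk : (0 < k)%N) :
  roumieu_equiv (iterated_matrix M j) (iterated_matrix M k) /\
  beurling_equiv (iterated_matrix M j) (iterated_matrix M k).
Proof.
have aM x : admissible (M x).
  by case: hM => -[_ /(_ x)[_ _ Mnd] _] /(_ x) MLC; exact: LC_admissible.
case: j hj => // j _; case: k hk => // k _.
split; split; try exact: iterated_matrix_roumieu_preceq;
  exact: iterated_matrix_beurling_preceq.
Qed.
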